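(* Let $H$ be any non-trivial amenable group. Then the following are equivalent. (1) $H^{(D)} \rtimes F$ is skew-amenable with respect to the product topology arising from the discrete topology on $H^{(D)}$ and the topology of pointwise convergence on $F$. (2) The (discrete) group $F$ is amenable.
   Context: For a topological group $G$ and $g\in G$ let $\lambda_g\colon G\to G,\ x\mapsto gx$. $\mathrm{LUCB}(G)$ is the algebra of bounded functions $f\colon G\to\mathbb{R}$ that are left-uniformly continuous, i.e., for every $\epsilon>0$ there is a neighborhood $U$ of the neutral element with $|f(x)-f(y)|\le\epsilon$ whenever $x^{-1}y\in U$. A mean on $\mathrm{LUCB}(G)$ is a positive linear functional $\mu$ with $\mu(\mathbf 1)=1$. $G$ is skew-amenable if $\mathrm{LUCB}(G)$ admits a mean $\mu$ with $\mu(f\circ\lambda_g)=\mu(f)$ for all $f\in\mathrm{LUCB}(G)$, $g\in G$. The group $H$ is amenable as a discrete group. Let $D=[0,1]\cap\mathbb{Z}[\tfrac12]$. Thompson's group $F$ is here viewed as the subgroup of $\mathrm{Aut}(D,\leq)$ (order-automorphisms of $D$) consisting of those elements which are piecewise affine (with finitely many pieces and breakpoints in $\mathbb{Z}[\tfrac12]$) and have all slopes in $\{2^k\mid k\in\mathbb{Z}\}$. The topology of pointwise convergence on $F$ is the one induced by its action on the discrete space $D$ (pointwise stabilizers of finite subsets of $D$ form a neighborhood basis of the identity). $H^{(D)}=\bigoplus_D H$ is the group of finitely supported functions $D\to H$. $F$ acts on it by $(g\boldsymbol{.}f)(x)=f(g^{-1}x)$, and $H^{(D)}\rtimes F$ is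 the corresponding semi-direct product with multiplication $(f,g)(f',g')=(f\cdot(g\boldsymbol{.}f'),gg')$. *)

(* Defs.v *)
From HB Require Import structures.
From mathcomp Require Import all_boot all_order all_algebra finmap.
From mathcomp Require Import all_classical all_reals all_analysis.
Import numFieldNormedType.Exports.

Set Implicit Arguments.
Unset Strict Implicit.
Unset Printing Implicit Defensive.

Import Order.TTheory GRing.Theory Num.Theory.

Local Open Scope classical_set_scope.
Local Open Scope ring_scope.

(* Topological groups; no separation axiom is required. *)

HB.mixin Record isTopologicalGroup G of Group G & Topological G := {
  mulg_continuous : continuous (fun x : G * G => (x.1 * x.2)%g);
  invg_continuous : continuous (fun x : G => x^-1%g)
}.

#[short(type="topologicalGroupType")]
HB.structure Definition TopologicalGroup :=
  {G of Group G & Topological G & isTopologicalGroup G}.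

Section Means.
Context {R : realType}.

(* A mean on a space [A] of real functions is encoded by a total function on
   [T -> R], whose values outside of [A] are irrelevant. *)
Definition is_mean (T : Type) (A : set (T -> R)) (mu : (T -> R) -> R) : Prop :=
  [/\ forall (a b : R) (f g : T -> R), A f -> A g ->
        mu (fun x => a * f x + b * g x) = a * mu f + b * mu g,
      forall f : T -> R, A f -> (forall x, 0 <= f x) -> 0 <= mu f
    & mu (fun=> 1) = 1].

Definition left_invariant (G : groupType) (A : set (G -> R))
    (mu : (G -> R) -> R) : Prop :=
  forall (f : G -> R) (g : G), A f -> mu (fun x => f (g * x)%g) = mu f.

Definition left_uniformly_continuous (G : topologicalGroupType) (f : G -> R)
    : Prop :=
  forall e : R, 0 < e ->
    exists2 U : set G, nbhs (1%g : G) U &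
      forall x y : G, U (x^-1 * y)%g -> `|f x - f y| <= e.

Definition LUCB (G : topologicalGroupType) : set (G -> R) :=
  [set f : G -> R | bounded_fun f /\ left_uniformly_continuous f].

End Means.

Definition skew_amenable (R : realType) (G : topologicalGroupType) : Prop :=
  exists mu : (G -> R) -> R,
    is_mean (LUCB (G := G)) mu /\ left_invariant (LUCB (G := G)) mu.

(* Amenability of [G] as a discrete group: a left-invariant mean on all bounded
   functions. *)
Definition amenable (R : realType) (G : groupType) : Prop :=
  exists mu : (G -> R) -> R,
    is_mean (bounded_fun : set (G -> R)) mu /\
    left_invariant (bounded_fun : set (G -> R)) mu.

Section OrderAutomorphisms.
Context {d : Order.disp_t} (T : porderType d).

Definition is_order_aut (f : T -> T) : Prop :=
  bijective f /\ {mono f : x y / (x <= y)%O}.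

Record order_aut := OrderAut {
  order_aut_fun :> T -> T;
  order_autP : `[< is_order_aut order_aut_fun >]
}.

HB.instance Definition _ := [isSub for order_aut_fun].
HB.instance Definition _ := [Choice of order_aut by <:].

Implicit Types f g h : order_aut.

Lemma order_aut_mono f : {mono f : x y / (x <= y)%O}.
Proof. by have /asboolP[] := order_autP f. Qed.

Lemma order_aut_ext f g : f =1 g -> f = g.
Proof. by move=> fg; apply/val_inj/funext. Qed.

Lemma order_aut_has_inv f : exists g : T -> T, cancel f g /\ cancel g f.
Proof. by have /asboolP[[g fK gK] _] := order_autP f; exists g. Qed.

Definition order_aut_inv_fun f : T -> T := projT1 (cid (order_aut_has_inv f)).

Lemma order_aut_invK f : cancel (order_aut_inv_fun f) f.
Proof. by rewrite /order_aut_inv_fun; case: cid => g []. Qed.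

Lemma order_autK f : cancel f (order_aut_inv_fun f).
Proof. by rewrite /order_aut_inv_fun; case: cid => g []. Qed.

Lemma order_aut1_subproof : `[< is_order_aut (@id T) >].
Proof. by apply/asboolP; split=> //; exists id. Qed.

Lemma order_autM_subproof f g : `[< is_order_aut (f \o g) >].
Proof.
apply/asboolP; split=> [|x y /=]; last by rewrite !order_aut_mono.
by apply: bij_comp; [have /asboolP[] := order_autP f
                    |have /asboolP[] := order_autP g].
Qed.

Lemma order_autV_subproof f : `[< is_order_aut (order_aut_inv_fun f) >].
Proof.
apply/asboolP; split.
  exists (f : T -> T); [exact: order_aut_invK|exact: order_autK].
by move=> x y; rewrite -(order_aut_mono f) !order_aut_invK.
Qed.

Definition order_aut1 := OrderAut order_aut1_subproof.
Definition order_autM f g := OrderAut (order_autM_subproof f g).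
Definition order_autV f := OrderAut (order_autV_subproof f).

Fact order_autMA : associative order_autM.
Proof. by move=> f g h; apply: order_aut_ext. Qed.
Fact order_aut1M : left_id order_aut1 order_autM.
Proof. by move=> f; apply: order_aut_ext. Qed.
Fact order_autM1 : right_id order_aut1 order_autM.
Proof. by move=> f; apply: order_aut_ext. Qed.
Fact order_autVM : left_inverse order_aut1 order_autV order_autM.
Proof. by move=> f; apply: order_aut_ext => x /=; rewrite order_autK. Qed.
Fact order_autMV : right_inverse order_aut1 order_autV order_autM.
Proof. by move=> f; apply: order_aut_ext => x /=; rewrite order_aut_invK. Qed.

HB.instance Definition _ := isGroup.Build order_aut
  order_autMA order_aut1M order_autM1 order_autVM order_autMV.

Lemma order_autME f g x : (f * g)%g x = f (g x). Proof. by []. Qed.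
Lemma order_aut1E x : (1%g : order_aut) x = x. Proof. by []. Qed.
Lemma order_autVK f x : f^-1%g (f x) = x.
Proof. exact: order_autK. Qed.
Lemma order_autKV f x : f (f^-1%g x) = x.
Proof. exact: order_aut_invK. Qed.

(* The topology of pointwise convergence for the action on the discrete
   space [T]. *)
HB.instance Definition _ := Topological.copy order_aut
  (initial_topology (order_aut_fun : order_aut -> {ptws T -> discrete_topology T})).

End OrderAutomorphisms.

Definition dyadic (q : rat) : Prop :=
  exists (m : int) (n : nat), q = m%:~R / 2 ^+ n.

Record dyadic_unit := DyadicUnit {
  dyadic_val :> rat;
  dyadic_unitP : (0 <= dyadic_val <= 1) && `[< dyadic dyadic_val >]
}.

HB.instance Definition _ := [isSub for dyadic_val].
HB.instance Definition _ := [Choice of dyadic_unit by <:].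
Fact dyadic_unit_display : Order.disp_t. Proof. exact: Order.Disp tt tt. Qed.
HB.instance Definition _ :=
  [SubChoice_isSubOrder of dyadic_unit by <: with dyadic_unit_display].

Lemma dyadic_unit0_subproof : (0 <= (0 : rat) <= 1) && `[< dyadic 0 >].
Proof. by apply/andP; split=> //; apply/asboolP; exists 0, 0%N. Qed.
Lemma dyadic_unit1_subproof : (0 <= (1 : rat) <= 1) && `[< dyadic 1 >].
Proof. by apply/andP; split=> //; apply/asboolP; exists 1, 0%N. Qed.
Definition dyadic0 := DyadicUnit dyadic_unit0_subproof.
Definition dyadic1 := DyadicUnit dyadic_unit1_subproof.

Section ThompsonF.
Local Notation D := dyadic_unit.

Definition pow2_affine_on (g : D -> D) (u v : D) : Prop :=
  exists (k : int) (b : rat), forall x : D, (u <= x <= v)%O ->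
    dyadic_val (g x) = 2 ^ k * dyadic_val x + b.

(* [dyadic0 :: s] lists the endpoints of the pieces in increasing order. *)
Definition is_piecewise_pow2_affine (g : D -> D) : Prop :=
  exists s : seq D,
    path (fun u v => (u < v)%O && `[< pow2_affine_on g u v >]) dyadic0 s /\
    last dyadic0 s = dyadic1.

Record thompsonF := ThompsonF {
  thompsonF_aut :> order_aut D;
  thompsonFP : `[< is_piecewise_pow2_affine thompsonF_aut >]
}.

HB.instance Definition _ := [isSub for thompsonF_aut].
HB.instance Definition _ := [Choice of thompsonF by <:].

Lemma dyadic0_le (x : D) : (dyadic0 <= x)%O.
Proof. by rewrite -Order.le_val; have /andP[/andP[]] := dyadic_unitP x. Qed.
Lemma dyadic1_ge (x : D) : (x <= dyadic1)%O.
Proof. by rewrite -Order.le_val; have /andP[/andP[]] := dyadic_unitP x. Qed.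

Lemma is_piecewise_pow2_affineP (g : D -> D) :
  is_piecewise_pow2_affine g <->
  exists S : seq D, forall u v : D, (u < v)%O ->
    (forall w, w \in S -> ~~ (u < w < v)%O) -> pow2_affine_on g u v.
Proof.
split=> [[s [gs s1]]|[S gS]].
  exists s => u v uv; move: gs s1.
  have : (dyadic0 <= u)%O by exact: dyadic0_le.
  move: dyadic0; elim: s => [|b s IHs] a au /=.
    move=> _ a1 _; move: (lt_le_trans uv (dyadic1_ge v)).
    by rewrite -a1 ltNge au.
  move=> /andP[/andP[ab /asboolP gab] gs] s1 suv.
  have [bu|ub] := leP b u.
    by apply: (IHs b) => // w ws; apply: suv; rewrite in_cons ws orbT.
  have vb : (v <= b)%O.
    by have := suv b (mem_head _ _); rewrite ub /= -leNgt.
  have [k [c gc]] := gab; exists k, c => x /andP[ux xv]; apply: gc.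
  by rewrite (le_trans au ux) (le_trans xv vb).
pose l := sort <=%O [seq x <- undup (dyadic1 :: S) | (dyadic0 < x)%O].
have lS w : (w \in l) = (dyadic0 < w)%O && (w \in dyadic1 :: S).
  by rewrite mem_sort mem_filter mem_undup.
have : path <%O dyadic0 l.
  rewrite path_min_sorted; last by apply/allP => x; rewrite lS => /andP[].
  by rewrite sort_lt_sorted filter_uniq ?undup_uniq.
have : forall w, w \in S -> (w <= dyadic0)%O || (w \in l).
  move=> w wS; rewrite lS in_cons wS orbT andbT.
  by case: leP => //=; rewrite ltNge dyadic0_le.
have : last dyadic0 l = dyadic1.
  have l1 : dyadic1 \in l by rewrite lS mem_head andbT lt_def -Order.le_val.
  have sl : path <=%O dyadic0 l.
    rewrite path_min_sorted ?sort_le_sorted//.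
    by apply/allP => x _; exact: dyadic0_le.
  apply/eqP; rewrite eq_le dyadic1_ge /=.
  case/lastP: (l) l1 sl => // l' z; rewrite last_rcons mem_rcons in_cons.
  case/predU1P => [-> //|l'1].
  rewrite (path_pairwise le_trans) -rcons_cons pairwise_rcons => /andP[+ _].
  by move=> /allP/(_ dyadic1); apply; rewrite in_cons l'1 orbT.
move=> l1 Sl ltl; exists l; split=> //; clear l1 lS.
move: dyadic0 Sl ltl; elim: (l) => //= b l' IHl a Sl /andP[ab bl'].
rewrite ab IHl ?andbT//=; last first.
  move=> w /Sl /orP[wa|]; first by rewrite (le_trans wa (ltW ab)).
  by rewrite in_cons => /predU1P[->|->]; rewrite ?lexx ?orbT.
apply/asboolP/gS => // w /Sl; rewrite in_cons => /or3P[wa|/eqP ->|wl'].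
- by rewrite ltNge wa.
- by rewrite ltxx andbF.
- have /allP/(_ _ wl') := order_path_min lt_trans bl'.
  by move=> /ltW bw; rewrite [(w < b)%O]ltNge bw andbF.
Qed.

Lemma thompsonF_group_closed :
  group_closed [pred g : order_aut D | `[< is_piecewise_pow2_affine g >]].
Proof.
have lt_aut (g : order_aut D) : {mono g : x y / (x < y)%O}.
  exact: leW_mono (order_aut_mono g).
have inv_closed (g : order_aut D) :
    is_piecewise_pow2_affine g -> is_piecewise_pow2_affine g^-1%g.
  move=> /is_piecewise_pow2_affineP[S gS].
  apply/is_piecewise_pow2_affineP; exists (map g S) => u v uv Suv.
  have [||k [b gb]] := gS (g^-1%g u) (g^-1%g v).
  - by rewrite lt_aut.
  - move=> w wS; rewrite -(lt_aut g) -[(w < _)%O](lt_aut g) !order_autKV.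
    by apply: Suv; exact: map_f.
  exists (- k), (- (2 ^ (- k) * b)) => x /andP[ux xv].
  have := gb (g^-1%g x); rewrite !order_aut_mono ux xv order_autKV => -> //.
  by rewrite mulrDr mulrA -expfzDr// addNr expr0z mul1r addrK.
split=> [|g h].
  apply/asboolP; apply/is_piecewise_pow2_affineP; exists [::] => u v _ _.
  by exists 0, 0 => x _; rewrite expr0z mul1r addr0.
move=> /asboolP gF /asboolP/inv_closed hF.
have /is_piecewise_pow2_affineP[Sg gS] := gF.
have /is_piecewise_pow2_affineP[Sh hS] := hF.
apply/asboolP; apply/is_piecewise_pow2_affineP.
exists (Sh ++ map (h : D -> D) Sg) => u v uv Suv.
have [||k [b gb]] := gS (h^-1%g u) (h^-1%g v).
- by rewrite lt_aut.
- move=> w wS; rewrite -(lt_aut h) -[(w < _)%O](lt_aut h) !order_autKV.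
  by apply: Suv; rewrite mem_cat map_f ?orbT.
have [|l [c hc]] := hS u v uv.
  by move=> w wS; apply: Suv; rewrite mem_cat wS.
exists (k + l), (2 ^ k * c + b) => x uxv; rewrite order_autME gb.
  by rewrite hc// expfzDr// mulrDr mulrA addrA.
by rewrite !order_aut_mono.
Qed.

HB.instance Definition _ :=
  SubChoice_isSubGroup.Build _ _ thompsonF thompsonF_group_closed.

HB.instance Definition _ := Topological.copy thompsonF
  (initial_topology (thompsonF_aut : thompsonF -> order_aut D)).

End ThompsonF.

(* The neighborhoods of an automorphism are given by its restrictions to finite
   sets; at the identity these are the pointwise stabilizers of finite sets. *)
Section PointwiseTopology.
Context {d : Order.disp_t} (T : porderType d).

Lemma order_aut_nbhsE (g : order_aut T) (A : set (order_aut T)) :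
  nbhs g A <-> exists s : seq T,
    [set h : order_aut T | {in s, h =1 g}] `<=` A.
Proof.
pose W := {ptws T -> discrete_topology T}.
have finE (f : W) (l : seq (set W)) :
    (forall M, M \in l -> exists x : T, forall h : W, h x = f x -> M h) ->
    exists s : seq T, forall M, M \in l -> forall h : W,
      (forall x, x \in s -> h x = f x) -> M h.
  elim: l => [|M l IHl] Ml; first by exists [::].
  have [|s sl] := IHl; first by move=> N Nl; apply: Ml; rewrite in_cons Nl orbT.
  have [x xM] := Ml M (mem_head _ _).
  exists (x :: s) => N; rewrite in_cons => /predU1P[->|Nl] h hf.
    by apply: xM; apply: hf; exact: mem_head.
  by apply: (sl N Nl) => y ys; apply: hf; rewrite in_cons ys orbT.
have ptwsE (f : W) (B : set W) : nbhs f B -> exists s : seq T,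
    [set h : W | forall x, x \in s -> h x = f x] `<=` B.
  move=> [] P [] [] Q QfinP <- [] V JV Vf VB.
  have [L Lsub LV] := QfinP _ JV.
  have [|s sL] := finE f (enum_fset L).
    move=> M LM; move: Vf; rewrite -LV => /(_ _ LM) Mf.
    have := Lsub _ LM; rewrite inE => -[x _ [U _ UM]].
    by exists x => h hx; move: Mf; rewrite -UM /= /preimage /= hx.
  exists s => h hf; apply: VB; exists V => //.
  suff : V h by [].
  by rewrite -LV => M LM; exact: (sL M LM).
split=> [|[s sA]].
  move=> [_ [[B oB <-] Bg BA]].
  have [|s sB] := ptwsE (g : T -> T) B; first exact: open_nbhs_nbhs.
  by exists s => h hg; apply: BA; exact: sB.
apply: filterS sA _.
elim: s => [|x s IHs]; first exact: filterS filterT.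
have gx : \forall h \near g, (h : order_aut T) x = g x.
  have := @initial_continuous _ W (@order_aut_fun d T) g.
  move=> /(_ (fun h => h x = g x)); apply.
  have := @proj_continuous T (fun=> discrete_topology T) x (g : T -> T).
  move=> /(_ [set g x]); apply; exact: discrete_set1.
near=> h => y; rewrite in_cons => /predU1P[->|].
  by near: h.
by move: y; near: h.
Unshelve. all: by end_near. Qed.

End PointwiseTopology.

Lemma thompsonF_nbhsE (g : thompsonF) (A : set thompsonF) :
  nbhs g A <-> exists s : seq dyadic_unit,
    [set h : thompsonF | {in s, (h : order_aut _) =1 g}] `<=` A.
Proof.
split=> [|[s sA]].
  move=> [_ [[B oB <-] Bg BA]].
  have /order_aut_nbhsE[s sB] : nbhs (thompsonF_aut g) B by exact: open_nbhs_nbhs.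
  by exists s => h hg; apply: BA; exact: sB.
apply: filterS sA _.
have := @initial_continuous _ _ thompsonF_aut g.
move=> /(_ [set h : order_aut dyadic_unit | {in s, h =1 (g : order_aut _)}]); apply.
by apply/order_aut_nbhsE; exists s.
Qed.

(* The direct sum H^(X), with the discrete topology. *)
Section DirectSum.
Context (X : choiceType) (H : groupType).

Definition dsum := {fsfun X -> H for fun=> 1%g}.

HB.instance Definition _ := Choice.on dsum.

Implicit Types f g h : dsum.

Definition dsum1 : dsum := [fsfun].
Definition dsumM f g : dsum :=
  [fsfun x in (finsupp f `|` finsupp g)%fset => (f x * g x)%g].
Definition dsumV f : dsum := [fsfun x in finsupp f => (f x)^-1%g].

Lemma dsum1_apply x : dsum1 x = 1%g.
Proof. exact: fsfun0E. Qed.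

Lemma dsumM_apply f g x : dsumM f g x = (f x * g x)%g.
Proof.
rewrite fsfun_fun in_fsetU.
by case: (finsuppP f x); case: (finsuppP g x); rewrite /= ?mulg1.
Qed.

Lemma dsumV_apply f x : dsumV f x = (f x)^-1%g.
Proof. by rewrite fsfun_fun; case: finsuppP => // _; rewrite invg1. Qed.

Fact dsumMA : associative dsumM.
Proof. by move=> f g h; apply/fsfunP => x; rewrite !dsumM_apply mulgA. Qed.
Fact dsum1M : left_id dsum1 dsumM.
Proof. by move=> f; apply/fsfunP => x; rewrite dsumM_apply dsum1_apply mul1g. Qed.
Fact dsumM1 : right_id dsum1 dsumM.
Proof. by move=> f; apply/fsfunP => x; rewrite dsumM_apply dsum1_apply mulg1. Qed.
Fact dsumVM : left_inverse dsum1 dsumV dsumM.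
Proof.
by move=> f; apply/fsfunP => x; rewrite dsumM_apply dsumV_apply dsum1_apply mulVg.
Qed.
Fact dsumMV : right_inverse dsum1 dsumV dsumM.
Proof.
by move=> f; apply/fsfunP => x; rewrite dsumM_apply dsumV_apply dsum1_apply mulgV.
Qed.

HB.instance Definition _ :=
  isGroup.Build dsum dsumMA dsum1M dsumM1 dsumVM dsumMV.

HB.instance Definition _ := hasNbhs.Build dsum principal_filter.
HB.instance Definition _ := Discrete_ofNbhs.Build dsum erefl.

Lemma dsum1E x : (1%g : dsum) x = 1%g. Proof. exact: dsum1_apply. Qed.
Lemma dsumME f g x : (f * g)%g x = (f x * g x)%g. Proof. exact: dsumM_apply. Qed.
Lemma dsumVE f x : (f^-1)%g x = (f x)^-1%g. Proof. exact: dsumV_apply. Qed.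

End DirectSum.

Section SemidirectProduct.
Context (H : groupType).
Local Notation D := dyadic_unit.
Local Notation F := thompsonF.

(* See [thompsonF_actE]: this is the function x |-> f (g^-1 x). *)
Definition thompsonF_act (g : F) (f : dsum D H) : dsum D H :=
  [fsfun x in [fset g y | y in finsupp f]%fset => f ((g^-1)%g x)].

Lemma thompsonFVE (g : F) : (g^-1)%g = (thompsonF_aut g)^-1%g :> order_aut D.
Proof. by []. Qed.

Lemma thompsonF_actE g f x : thompsonF_act g f x = f ((g^-1)%g x).
Proof.
rewrite fsfun_fun; case: ifPn => // /imfsetP/= gx.
case: finsuppP => // fx; case: gx.
by exists ((g^-1)%g x); rewrite // thompsonFVE order_autKV.
Qed.

(* The semi-direct product H^(D) ><| F. The alias keeps its group law apart from
   the componentwise one that products of groups carry by default. *)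
Definition wreathF : Type := (dsum D H * F)%type.

HB.instance Definition _ := Choice.copy wreathF (dsum D H * F)%type.

Definition wreathF1 : wreathF := (1%g, 1%g).
Definition wreathFM (a b : wreathF) : wreathF :=
  ((a.1 * thompsonF_act a.2 b.1)%g, (a.2 * b.2)%g).
Definition wreathFV (a : wreathF) : wreathF :=
  (thompsonF_act a.2^-1%g a.1^-1%g, a.2^-1%g).

Lemma thompsonF_act1 f : thompsonF_act 1%g f = f.
Proof.
by apply/fsfunP => x; rewrite thompsonF_actE invg1.
Qed.
Lemma thompsonF_actM g h f :
  thompsonF_act (g * h)%g f = thompsonF_act g (thompsonF_act h f).
Proof. by apply/fsfunP => x; rewrite !thompsonF_actE invgM. Qed.
Lemma thompsonF_act_mul g f f' :
  thompsonF_act g (f * f')%g = (thompsonF_act g f * thompsonF_act g f')%g.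
Proof. by apply/fsfunP => x; rewrite dsumME !thompsonF_actE dsumME. Qed.
Lemma thompsonF_act_one g : thompsonF_act g 1%g = 1%g.
Proof. by apply/fsfunP => x; rewrite thompsonF_actE !dsum1E. Qed.

Fact wreathFMA : associative wreathFM.
Proof.
move=> a b c; rewrite /wreathFM /=.
by rewrite thompsonF_act_mul thompsonF_actM !mulgA.
Qed.
Fact wreathF1M : left_id wreathF1 wreathFM.
Proof. by move=> [f g]; rewrite /wreathFM /= thompsonF_act1 !mul1g. Qed.
Fact wreathFM1 : right_id wreathF1 wreathFM.
Proof. by move=> [f g]; rewrite /wreathFM /= thompsonF_act_one !mulg1. Qed.
Fact wreathFVM : left_inverse wreathF1 wreathFV wreathFM.
Proof.
move=> [f g]; rewrite /wreathFM /wreathFV /= -thompsonF_act_mul !mulVg.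
by rewrite thompsonF_act_one.
Qed.
Fact wreathFMV : right_inverse wreathF1 wreathFV wreathFM.
Proof.
move=> [f g]; rewrite /wreathFM /wreathFV /= -thompsonF_actM !mulgV.
by rewrite thompsonF_act1 mulgV.
Qed.

HB.instance Definition _ :=
  isGroup.Build wreathF wreathFMA wreathF1M wreathFM1 wreathFVM wreathFMV.

HB.instance Definition _ := Topological.copy wreathF (dsum D H * F)%type.

Lemma wreathF_nbhsE (a : wreathF) (A : set wreathF) :
  nbhs a A <-> exists s : seq D,
    [set b : wreathF | b.1 = a.1 /\ {in s, (b.2 : order_aut D) =1 a.2}] `<=` A.
Proof.
split=> [[[P Q]] [/= Pa /thompsonF_nbhsE[s sQ] PQA]|[s sA]].
  exists s => b [b1 b2]; apply: PQA; split=> /=; last exact: sQ.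
  by rewrite b1; exact: (@nbhs_singleton (dsum D H)).
exists ([set a.1], [set h : F | {in s, (h : order_aut D) =1 a.2}]) => /=.
  by split; [exact: discrete_set1|apply/thompsonF_nbhsE; exists s].
by move=> b /= b12; exact: sA.
Qed.

Lemma thompsonF_act_eq (g h : F) (f : dsum D H) :
  {in finsupp f, (h : order_aut D) =1 g} -> thompsonF_act h f = thompsonF_act g f.
Proof.
move=> hg; apply/fsfunP => x; rewrite !thompsonF_actE !thompsonFVE.
have gK := order_autVK (g : order_aut D); have gKV := order_autKV (g : order_aut D).
have hK := order_autVK (h : order_aut D); have hKV := order_autKV (h : order_aut D).
case: (boolP ((h : order_aut D)^-1%g x \in finsupp f)) => [yf|].
  by congr (f _); apply: (can_inj gK); rewrite gKV -hg// hKV.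
case: (boolP ((g : order_aut D)^-1%g x \in finsupp f)) => [yf _|].
  by congr (f _); apply: (can_inj hK); rewrite hKV hg// gKV.
by move=> /fsfun_dflt -> /fsfun_dflt ->.
Qed.

Fact wreathF_mulg_continuous :
  continuous (fun a : wreathF * wreathF => (a.1 * a.2)%g).
Proof.
move=> [[f g] [f' g']] A /wreathF_nbhsE[s sA].
exists ([set b : wreathF | b.1 = f /\
           {in map (g' : D -> D) s ++ finsupp f', (b.2 : order_aut D) =1 g}],
        [set b : wreathF | b.1 = f' /\ {in s, (b.2 : order_aut D) =1 g'}]) => /=.
  split; apply/wreathF_nbhsE; first by exists (map (g' : D -> D) s ++ finsupp f').
  by exists s.
move=> [[f1 g1] [f2 g2]] /= [[-> hg1] [-> hg2]]; apply: sA; split=> /=.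
  congr (_ * _)%g; apply: thompsonF_act_eq => x xf.
  by apply: hg1; rewrite mem_cat xf orbT.
move=> x xs /=; rewrite hg2// hg1//.
by rewrite mem_cat map_f.
Qed.

Fact wreathF_invg_continuous : continuous (fun a : wreathF => a^-1%g).
Proof.
move=> [f g] A /wreathF_nbhsE[s sA]; apply/wreathF_nbhsE.
pose s' := s ++ finsupp (f^-1)%g.
exists (map (g^-1%g : D -> D) s') => -[f1 g1] /= [-> hg1].
have gVE : {in s', ((g1^-1)%g : order_aut D) =1 (g^-1)%g}.
  move=> x xs; apply: (can_inj (order_autVK (g1 : order_aut D))).
  rewrite (hg1 ((g^-1)%g x)) ?map_f// !thompsonFVE.
  by rewrite (order_autKV (g1 : order_aut D)) (order_autKV (g : order_aut D)).
apply: sA; split=> /=; last by move=> x xs; apply: gVE; rewrite mem_cat xs.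
by apply: thompsonF_act_eq => x xf; apply: gVE; rewrite mem_cat xf orbT.
Qed.

HB.instance Definition _ := isTopologicalGroup.Build wreathF
  wreathF_mulg_continuous wreathF_invg_continuous.

End SemidirectProduct.

(* Main.v *)
Require Import Defs.
From HB Require Import structures.
From mathcomp Require Import all_boot all_order all_algebra finmap.
From mathcomp Require Import all_classical all_reals all_analysis.
From mathcomp Require Import lra.
Import numFieldNormedType.Exports.

Set Implicit Arguments.
Unset Strict Implicit.
Unset Printing Implicit Defensive.

Import Order.TTheory GRing.Theory Num.Theory.

Local Open Scope classical_set_scope.
Local Open Scope ring_scope.

(** Let D be the dyadic points of [0,1], N = H^(D) and G = N ><| F.

    If F is amenable, then so is the discrete group G, as an extension of F by
    N ([wreathF_amenable]), the group N being a directed union of finite powers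
    of H ([dsum_amenable]); a left-invariant mean on all bounded functions
    restricts to LUCB(G).

    Conversely, right multiplication by an element (1, u) leaves the N-component
    of (a, g) unchanged.  Hence every bounded function of that component alone
    lies in LUCB(G), and skew-amenability yields a mean on bounded functions of
    a : N which is invariant under translations by N and under the action of F
    ([skew_amenable_lamp_mean]).  Translation by a non-trivial element of H at
    the coordinate x shows that the event a(x) = 1 has weight at most 1/2.  So
    the support of a is an F-invariant random finite set S of points of D that
    misses any given point with weight at most 1/2.  The union of n independent
    copies of S misses it with weight at most 2^-n, and a limit point as n grows
    is an F-invariant mean on finite sets giving full weight to the sets that
    contain any prescribed finite set ([absorbing_mean], [absorbing_mean_eq]).

    It remains to go from finite sets to elements of F, and here the geometry of
    F enters.  Call S and T equivalent when some g in F that is affine between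
    consecutive points of S maps S onto T.  If S contains 0 and 1, such a g is
    unique: an order automorphism carrying S onto itself fixes S pointwise, and
    an affine map is determined by two values ([affine_off_fixed]).  Fix a
    representative of each class and let [marking_elt] S be the element of F
    carrying the representative of S to S.  Then [marking_elt] (h S) =
    h * [marking_elt] S as soon as S contains 0, 1 and the breakpoints of h
    ([marking_elt_equivariant]), which for each h is the case with full weight.
    Pushing the mean on finite sets forward along [marking_elt] gives a
    left-invariant mean on F. *)

(** * Means on bounded functions *)

Section Means.
Context {R : realType}.

Lemma bounded_fun_ex (T : Type) (f : T -> R) :
  bounded_fun f <-> exists M, forall x, `|f x| <= M.
Proof.
split=> [[M [_ fM]]|[M fM]].
  by exists (M + 1) => x; apply: fM => //; rewrite ltrDl.
by exists M; split; [exact: num_real|move=> N /ltW MN x _; exact: le_trans MN].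
Qed.

Lemma bounded_fun_bound (T : Type) (f : T -> R) M :
  (forall x, `|f x| <= M) -> bounded_fun f.
Proof. by move=> fM; apply/bounded_fun_ex; exists M. Qed.

Lemma bounded_fun_comp (T U : Type) (q : T -> U) (f : U -> R) :
  bounded_fun f -> bounded_fun (fun x => f (q x)).
Proof. by move=> /bounded_fun_ex[M fM]; apply: (@bounded_fun_bound _ _ M). Qed.

Lemma bounded_fun_cst (T : Type) (c : R) : bounded_fun (fun _ : T => c).
Proof. exact: (@bounded_fun_bound _ _ `|c|). Qed.

Lemma bounded_fun_sub (T : Type) (f g : T -> R) :
  bounded_fun f -> bounded_fun g -> bounded_fun (fun x => f x - g x).
Proof. by move=> bf bg; exact: bounded_funD bf (bounded_funN bg). Qed.

Lemma bounded_fun_indic (T : Type) (P : pred T) :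
  bounded_fun (fun x => (P x)%:R : R).
Proof.
apply: (@bounded_fun_bound _ _ 1) => x.
by case: (P x); rewrite ?normr1 ?normr0.
Qed.

Section BoundedMean.
Context (T : Type) (mu : (T -> R) -> R).
Hypothesis mean_mu : is_mean (bounded_fun : set (T -> R)) mu.
Implicit Types f g : T -> R.

Lemma meanD f g : bounded_fun f -> bounded_fun g ->
  mu (fun x => f x + g x) = mu f + mu g.
Proof.
have [lin _ _] := mean_mu; move=> bf bg; have := lin 1 1 f g bf bg.
by rewrite !mul1r => <-; congr mu; apply/funext => x; rewrite !mul1r.
Qed.

Lemma meanB f g : bounded_fun f -> bounded_fun g ->
  mu (fun x => f x - g x) = mu f - mu g.
Proof.
have [lin _ _] := mean_mu; move=> bf bg; have := lin 1 (-1) f g bf bg.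
by rewrite mul1r mulN1r => <-; congr mu; apply/funext => x; rewrite mul1r mulN1r.
Qed.

Lemma meanZ c f : bounded_fun f -> mu (fun x => c * f x) = c * mu f.
Proof.
have [lin _ _] := mean_mu; move=> bf; have := lin c 0 f f bf bf.
by rewrite mul0r addr0 => <-; congr mu; apply/funext => x; rewrite mul0r addr0.
Qed.

Lemma mean_cst c : mu (fun=> c) = c.
Proof.
have [_ _ mu1] := mean_mu; rewrite -[RHS]mulr1 -mu1 -meanZ.
  by congr mu; apply/funext => x; rewrite mulr1.
exact: bounded_fun_cst.
Qed.

Lemma mean_le f g : bounded_fun f -> bounded_fun g ->
  (forall x, f x <= g x) -> mu f <= mu g.
Proof.
have [_ pos _] := mean_mu; move=> bf bg fg; rewrite -subr_ge0 -meanB//.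
apply: pos => [|x]; last by rewrite subr_ge0.
exact: bounded_fun_sub.
Qed.

Lemma mean_norm_le f M : (forall x, `|f x| <= M) -> `|mu f| <= M.
Proof.
move=> fM; have bf := bounded_fun_bound fM.
have bM c := bounded_fun_cst T c.
rewrite ler_norml -{1}(mean_cst (- M)) -[X in _ && (_ <= X)]mean_cst.
apply/andP; split; apply: mean_le => // x.
  by have := fM x; rewrite ler_norml => /andP[].
by have := fM x; rewrite ler_norml => /andP[].
Qed.

End BoundedMean.

Lemma mean_comp (T U : Type) (A : set (T -> R)) (B : set (U -> R))
    (q : T -> U) (mu : (T -> R) -> R) :
    (forall f, B f -> A (fun x => f (q x))) -> is_mean A mu ->
  is_mean B (fun f => mu (fun x => f (q x))).
Proof.
move=> BA [lin pos mu1]; split=> //.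
- by move=> a b f g /BA Af /BA Ag; apply: lin.
- by move=> f /BA Af f0; apply: pos.
Qed.

Lemma mean_dirac (T : Type) (t : T) :
  is_mean (bounded_fun : set (T -> R)) (fun f => f t).
Proof. by split. Qed.

Lemma bounded_fun_mean (T U : Type) (k : T -> (U -> R) -> R) (f : T -> U -> R) M :
  (forall t, is_mean (bounded_fun : set (U -> R)) (k t)) ->
  (forall t u, `|f t u| <= M) -> bounded_fun (fun t => k t (f t)).
Proof.
move=> kmean fM; apply: (@bounded_fun_bound _ _ M) => t.
exact: (mean_norm_le (kmean t)).
Qed.

(** Integrating a family of means; iterated means, which replace product
    measures below, are obtained from this and [mean_comp]. *)
Lemma mean_bind (T U : Type) (mu : (T -> R) -> R) (k : T -> (U -> R) -> R) :
    is_mean (bounded_fun : set (T -> R)) mu ->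
    (forall t, is_mean (bounded_fun : set (U -> R)) (k t)) ->
  is_mean (bounded_fun : set (U -> R)) (fun f => mu (fun t => k t f)).
Proof.
move=> [lin pos mu1] kmean.
have bk f : bounded_fun f -> bounded_fun (fun t => k t f).
  by move=> /bounded_fun_ex[M fM]; apply: (bounded_fun_mean kmean).
split=> [a b f g bf bg|f bf f0|].
- rewrite -lin; [|exact: bk..]; congr mu; apply/funext => t.
  by have [-> ] := kmean t.
- by apply: pos => [|t]; [exact: bk|have [_ ->] := kmean t].
- by rewrite -[RHS]mu1; congr mu; apply/funext => t; have [_ _ ->] := kmean t.
Qed.

(** A limit along an ultrafilter refining F exists for every bounded function,
    by compactness of the segments of R, and agrees with the limit along F
    whenever the latter exists. *)
Lemma mean_limit (I T : Type) (F : set_system I) (mu : I -> (T -> R) -> R) :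
    ProperFilter F ->
    (forall i, is_mean (bounded_fun : set (T -> R)) (mu i)) ->
  exists2 nu, is_mean (bounded_fun : set (T -> R)) nu &
    forall f c, bounded_fun f -> mu i f @[i --> F] --> c -> nu f = c.
Proof.
move=> PF mumean; have [G [UG FG]] := ultraFilterLemma PF.
have cvgG f : bounded_fun f -> mu i f @[i --> G] --> lim (mu i f @[i --> G]).
  move=> /bounded_fun_ex[M fM].
  have GM : (mu i f @[i --> G]) `[- M, M]%classic.
    apply: (@filterE _ G) => i; rewrite /= in_itv /= -ler_norml.
    exact: (mean_norm_le (mumean i)).
  have [l [_ ml]] := segment_compact _ GM; apply/cvg_ex; exists l => A lA.
  have [//|GA] := in_ultra_setVsetC ((fun i => mu i f) @^-1` A) UG.
  by have [x [/= ? ?]] := ml (~` A) A GA lA.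
exists (fun f => lim (mu i f @[i --> G])).
  split=> [a b f g bf bg|f bf f0|].
  - apply: cvg_lim; first exact: Rhausdorff.
    have -> : (fun i => mu i (fun x => a * f x + b * g x)) =
              (fun i => a * mu i f + b * mu i g).
      by apply/funext => i; have [-> ] := mumean i.
    by apply: cvgD; apply: cvgMr; exact: cvgG.
  - apply: limr_ge; first by apply/cvg_ex; eexists; exact: cvgG.
    by apply: filterE => i; have [_ ->] := mumean i.
  - apply: cvg_lim; first exact: Rhausdorff.
    have -> : (fun i => mu i (fun=> 1)) = (fun=> 1).
      by apply/funext => i; have [_ _ ->] := mumean i.
    exact: cvg_cst.
move=> f c bf fc; apply: cvg_lim; first exact: Rhausdorff.
by move=> A /fc; exact: FG.
Qed.

End Means.

(** * Amenability of the discrete group *)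

Section DirectSumAmenable.
Context (R : realType) (X : choiceType) (H : groupType).
Local Notation N := (dsum X H).

Definition dsum_at (x : X) (k : H) : N := [fsfun y in [fset x]%fset => k].

Lemma dsum_atE x k y : dsum_at x k y = if y == x then k else 1%g.
Proof. by rewrite fsfun_fun in_fset1. Qed.

Lemma dsum_atM x (k l : H) : dsum_at x (k * l)%g = (dsum_at x k * dsum_at x l)%g.
Proof.
by apply/fsfunP => y; rewrite dsumME !dsum_atE; case: ifP; rewrite ?mulg1.
Qed.

(** Isolates the coordinate x: translations of N by elements supported in a
    finite set are treated one coordinate at a time. *)
Lemma dsum_split x (b : N) :
  exists2 b' : N, b = (dsum_at x (b x) * b')%g & finsupp b' = (finsupp b `\ x)%fset.
Proof.
exists ((dsum_at x (b x))^-1 * b)%g; first by rewrite mulVKg.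
apply/fsetP => y; rewrite in_fsetD1 !mem_finsupp dsumME dsumVE dsum_atE.
by case: (eqVneq y x) => [->|_]; rewrite /= ?mulVg ?eqxx// invg1 mul1g.
Qed.

Lemma dsum_at_comm x k (b : N) : x \notin finsupp b ->
  (b * dsum_at x k = dsum_at x k * b)%g.
Proof.
move=> /fsfun_dflt bx; apply/fsfunP => y; rewrite !dsumME dsum_atE.
by case: eqP => [->|_]; rewrite ?bx mul1g mulg1.
Qed.

(** Integrate over the coordinates of E one after the other, starting from the
    point mass at 1.  A translation by b splits into its x-part, absorbed by
    the mean of H, and the rest, which commutes with the coordinate x and is
    absorbed by the mean built for the remaining coordinates. *)
Lemma finite_support_mean (E : seq X) : amenable R H ->
  exists2 mu : (N -> R) -> R, is_mean (bounded_fun : set (N -> R)) mu &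
    forall (f : N -> R) (b : N), bounded_fun f -> {subset finsupp b <= E} ->
      mu (fun a => f (b * a)%g) = mu f.
Proof.
move=> [mH [mH_mean mH_inv]]; elim: E => [|x E [mu mu_mean mu_inv]].
  exists (fun f => f 1%g); first exact: mean_dirac.
  move=> f b _ b0; rewrite mulg1; congr f; apply/fsfunP => y.
  by rewrite dsum1E; apply/fsfun_dflt/negP => /b0.
exists (fun f => mH (fun k => mu (fun a => f (dsum_at x k * a)%g))).
  apply: mean_bind => // k; apply: mean_comp mu_mean => f; exact: bounded_fun_comp.
move=> f b bf bE; have [b' bE' sb'] := dsum_split x b.
have step k : mu (fun a => f (b * (dsum_at x k * a))%g) =
    mu (fun a => f (dsum_at x (b x * k)%g * a)%g).
  rewrite -(mu_inv (fun a => f (dsum_at x (b x * k)%g * a)%g) b').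
  - congr mu; apply/funext => a; congr f.
    rewrite {1}bE' dsum_atM -!mulgA; congr (_ * _)%g.
    by rewrite !mulgA dsum_at_comm// sb' in_fsetD1 eqxx.
  - exact: bounded_fun_comp.
  - move=> y; rewrite sb' in_fsetD1 => /andP[yx /bE].
    by rewrite in_cons (negbTE yx).
rewrite (_ : (fun k => _) =
    (fun k => (fun l => mu (fun a => f (dsum_at x l * a)%g)) (b x * k)%g)); last first.
  by apply/funext.
apply: mH_inv; have [M fM] := (bounded_fun_ex f).1 bf.
exact: (bounded_fun_mean (fun=> mu_mean) (fun k a => fM _)).
Qed.

(** Limit of the means of [finite_support_mean] along the finite subsets of X
    ordered by inclusion: every b has its support in all large enough sets. *)
Lemma dsum_amenable : amenable R H -> amenable R N.
Proof.
move=> Ham.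
have /choice[mu muP] (E : {fset X}) : exists mu : (N -> R) -> R,
    is_mean (bounded_fun : set (N -> R)) mu /\
    forall (f : N -> R) (b : N), bounded_fun f -> {subset finsupp b <= E} ->
      mu (fun a => f (b * a)%g) = mu f.
  by have [mu] := finite_support_mean E Ham; exists mu.
pose F := filter_from setT (fun E : {fset X} => [set T | E `<=` T]%fset).
have PF : ProperFilter F.
  apply: filter_from_proper => [|E _]; last by exists E => /=.
  apply: filter_fromT_filter; first by exists fset0.
  move=> E E'; exists (E `|` E')%fset => T /=.
  by rewrite fsubUset => /andP[].
have [nu nu_mean nu_lim] := mean_limit PF (fun E => (muP E).1).
exists nu; split=> // f b bf; apply/eqP; rewrite -subr_eq0.
have bfb : bounded_fun (fun a => f (b * a)%g) by exact: bounded_fun_comp.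
rewrite -(meanB nu_mean)//; apply/eqP; apply: nu_lim.
  exact: bounded_fun_sub.
apply: cvg_near_cst; exists (finsupp b) => //= T /fsubsetP bT.
by rewrite (meanB (muP T).1)// (muP T).2// subrr.
Qed.

End DirectSumAmenable.

(** The mean integrates over the products (1, g) * (a, 1) = (g.a, g) rather than
    over the pairs (a, g).  In this order, left translation by (b, h) replaces g
    by hg and a by (hg)^-1.b * a, so that only translation invariance of the
    mean on H^(D) is used, not its invariance under the action of F. *)
Lemma wreathF_amenable (R : realType) (H : groupType) :
  amenable R (dsum dyadic_unit H) -> amenable R thompsonF ->
  amenable R (wreathF H).
Proof.
move=> [mN [mN_mean mN_inv]] [mF [mF_mean mF_inv]].
pose w (g : thompsonF) (a : dsum dyadic_unit H) : wreathF H :=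
  (thompsonF_act g a, g).
exists (fun f => mF (fun g => mN (fun a => f (w g a)))); split.
  apply: mean_bind => // g; apply: mean_comp mN_mean => f; exact: bounded_fun_comp.
move=> f [b h] bf.
have step g : mN (fun a => f (((b, h) : wreathF H) * w g a)%g) =
    mN (fun a => f (w (h * g)%g a)).
  rewrite -(mN_inv (fun a => f (w (h * g)%g a)) (thompsonF_act (h * g)^-1%g b)).
    congr mN; apply/funext => a; congr f; congr pair.
    rewrite /= thompsonF_act_mul -!thompsonF_actM.
    by rewrite mulgV thompsonF_act1.
  exact: bounded_fun_comp.
rewrite (_ : (fun g => _) =
    (fun g => (fun l => mN (fun a => f (w l a))) (h * g)%g)); last by apply/funext.
apply: mF_inv; have [M fM] := (bounded_fun_ex f).1 bf.
exact: (bounded_fun_mean (fun=> mN_mean) (fun k a => fM _)).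
Qed.

Lemma amenable_skew_amenable (R : realType) (G : topologicalGroupType) :
  amenable R G -> skew_amenable R G.
Proof.
move=> [mu [mu_mean mu_inv]]; exists mu; split; last by move=> f g [/mu_inv].
by apply: (mean_comp (q := id) _ mu_mean) => f [].
Qed.

(** * Means on finite sets *)

Section AbsorbingMean.
Context (R : realType) (X : choiceType).
Local Notation FS := {fset X}.

Section Convolution.
Context (m : (FS -> R) -> R).
Hypothesis m_mean : is_mean (bounded_fun : set (FS -> R)) m.

(** The mean of f over S_1 `|` ... `|` S_n, where the S_i are independent copies
    of a random set of law m. *)
Fixpoint union_mean (n : nat) (f : FS -> R) : R :=
  if n is n'.+1 then m (fun S => union_mean n' (fun T => f (S `|` T)%fset))
  else f fset0.

Lemma union_mean_mean n : is_mean (bounded_fun : set (FS -> R)) (union_mean n).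
Proof.
elim: n => [|n IHn]; first exact: mean_dirac.
by apply: mean_bind => // S; apply: mean_comp IHn => f; exact: bounded_fun_comp.
Qed.

Lemma union_mean_avoid n x :
  union_mean n (fun S => (x \notin S)%:R) = m (fun S => (x \notin S)%:R) ^+ n.
Proof.
elim: n => [//|n IHn] /=.
rewrite exprSr -IHn -(meanZ m_mean); last exact: bounded_fun_indic.
congr m; apply/funext => S.
rewrite mulrC -(meanZ (union_mean_mean n)); last exact: bounded_fun_indic.
by congr union_mean; apply/funext => T; rewrite inE negb_or -natrM mulnb.
Qed.

Lemma union_mean_invariant n (g : X -> X) :
    (forall f, bounded_fun f -> m (fun S => f (g @` S)%fset) = m f) ->
  forall f, bounded_fun f ->
    union_mean n (fun S => f (g @` S)%fset) = union_mean n f.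
Proof.
move=> m_inv; elim: n => [|n IHn] f bf /=; first by rewrite imfset0.
pose u S := union_mean n (fun T => f (S `|` T)%fset).
rewrite -/u -(m_inv u).
  congr m; apply/funext => S; rewrite -[RHS]IHn; last exact: bounded_fun_comp.
  by congr union_mean; apply/funext => T; rewrite imfsetU.
have [M fM] := (bounded_fun_ex f).1 bf.
exact: (bounded_fun_mean (fun=> union_mean_mean n) (fun S T => fM _)).
Qed.

End Convolution.

(** Unions of many independent copies of a random set that catches each point
    with weight at least 1/2 catch it with weight tending to 1, and any
    invariance of m under a map g of X is inherited. *)
Lemma absorbing_mean (m : (FS -> R) -> R) :
    is_mean (bounded_fun : set (FS -> R)) m ->
    (forall x, m (fun S => (x \notin S)%:R) <= 2^-1) ->
  exists nu : (FS -> R) -> R,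
    [/\ is_mean (bounded_fun : set (FS -> R)) nu,
      forall x, nu (fun S => (x \notin S)%:R) = 0
    & forall g : X -> X,
        (forall f, bounded_fun f -> m (fun S => f (g @` S)%fset) = m f) ->
        forall f, bounded_fun f -> nu (fun S => f (g @` S)%fset) = nu f].
Proof.
move=> m_mean m_half.
have [nu nu_mean nu_lim] := mean_limit _ (union_mean_mean m_mean) (F := \oo).
exists nu; split=> // [x|g g_inv f bf].
  apply: nu_lim; first exact: bounded_fun_indic.
  under eq_fun do rewrite union_mean_avoid//.
  apply: cvg_expr; rewrite ger0_norm.
    by apply: (le_lt_trans (m_half x)); lra.
  by have [_ -> //] := m_mean; exact: bounded_fun_indic.
have bfg : bounded_fun (fun S : FS => f (g @` S)%fset).
  exact: (bounded_fun_comp (fun S : FS => g @` S)%fset bf).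
apply/eqP; rewrite -subr_eq0 -(meanB nu_mean)//; apply/eqP; apply: nu_lim.
  exact: bounded_fun_sub.
apply: cvg_near_cst; apply: filterE => n.
by rewrite (meanB (union_mean_mean m_mean n))// union_mean_invariant// subrr.
Qed.

(** If every single point is caught with full weight, then so is every finite
    set E, by the union bound; a bounded function may therefore be modified
    outside of the sets containing E. *)
Lemma absorbing_mean_eq (nu : (FS -> R) -> R) (E : FS) (f f' : FS -> R) :
    is_mean (bounded_fun : set (FS -> R)) nu ->
    (forall x, nu (fun S => (x \notin S)%:R) = 0) ->
    bounded_fun f -> bounded_fun f' ->
    (forall S, (E `<=` S)%fset -> f S = f' S) -> nu f = nu f'.
Proof.
move=> nu_mean nu0 bf bf' ff'.
have miss (s : seq X) : nu (fun S => (~~ all (mem S) s)%:R) <= 0.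
  elim: s => [|x s IHs]; first by rewrite /= (mean_cst nu_mean).
  have bi (P : pred FS) := @bounded_fun_indic R _ P.
  apply: le_trans (_ : nu (fun S => (x \notin S)%:R + (~~ all (mem S) s)%:R) <= 0).
    apply: mean_le => //; first exact: bounded_funD.
    move=> S /=; rewrite negb_and -natrD ler_nat.
    by case: (x \notin S) => //=; case: (~~ _).
  by rewrite (meanD nu_mean)// nu0 add0r.
have le_nu g g' : bounded_fun g -> bounded_fun g' ->
    (forall S, (E `<=` S)%fset -> g S = g' S) -> nu g <= nu g'.
  move=> bg bg' gg'.
  have /bounded_fun_ex[M gM] := bounded_fun_sub bg bg'.
  have M0 : 0 <= M by exact: le_trans (gM fset0).
  rewrite -subr_le0 -(meanB nu_mean)//.
  apply: le_trans (_ : nu (fun S => M * (~~ all (mem S) E)%:R) <= 0).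
    apply: mean_le => //; first exact: bounded_fun_sub.
      apply: (@bounded_fun_bound _ _ _ M) => S.
      by case: (~~ _); rewrite ?mulr1 ?mulr0 ?normr0 ?ger0_norm.
    move=> S; have [/allP ES|_] /= := boolP (all (mem S) E).
      by rewrite gg' ?subrr ?mulr0//; apply/fsubsetP.
    by rewrite mulr1 (le_trans (ler_norm _)).
  rewrite (meanZ nu_mean); last exact: bounded_fun_indic.
  by rewrite mulr_ge0_le0.
apply/eqP; rewrite eq_le !le_nu// => S ES; exact/esym/ff'.
Qed.

End AbsorbingMean.

(** * Finite sets of dyadic points as markings of elements of F *)

Section Markings.
Local Notation D := dyadic_unit.
Local Notation F := thompsonF.
Implicit Types (g h : F) (S T : {fset D}) (x y u v w : D).

(** The breakpoints of f inside ]0, 1[ lie in S.  Quantifying over intervals free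
    of points of S, rather than over consecutive points of an enumeration of S,
    makes the condition visibly monotone in S and stable under composition. *)
Definition affine_off (f : D -> D) S : Prop :=
  forall u v, (u < v)%O -> (forall w, w \in S -> ~~ (u < w < v)%O) ->
    pow2_affine_on f u v.

Lemma thompsonF_lt g : {mono (g : D -> D) : x y / (x < y)%O}.
Proof. exact: leW_mono (order_aut_mono (g : order_aut D)). Qed.

Lemma thompsonF_inj g : injective g.
Proof. exact: can_inj (order_autVK (g : order_aut D)). Qed.

Lemma thompsonFK g : cancel g (g^-1)%g.
Proof. exact: (order_autVK (g : order_aut D)). Qed.

Lemma thompsonFKV g : cancel (g^-1)%g g.
Proof. exact: (order_autKV (g : order_aut D)). Qed.

Lemma thompsonF_ext g h : g =1 h -> g = h.
Proof. by move=> gh; apply/val_inj/order_aut_ext. Qed.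

Lemma thompsonF_fix0 g : g dyadic0 = dyadic0.
Proof.
apply/eqP; rewrite eq_le dyadic0_le andbT.
by rewrite -{2}(thompsonFKV g dyadic0) order_aut_mono dyadic0_le.
Qed.

Lemma thompsonF_fix1 g : g dyadic1 = dyadic1.
Proof.
apply/eqP; rewrite eq_le dyadic1_ge /=.
by rewrite -{1}(thompsonFKV g dyadic1) order_aut_mono dyadic1_ge.
Qed.

Lemma affine_off_ex g : exists S, affine_off g S.
Proof.
have /asboolP/is_piecewise_pow2_affineP[s gs] := thompsonFP g.
exists [fset w in s]%fset => u v uv suv; apply: gs => // w ws.
by apply: suv; rewrite inE.
Qed.

Lemma affine_off_sub g S T : (S `<=` T)%fset -> affine_off g S -> affine_off g T.
Proof.
by move=> /fsubsetP ST gS u v uv Tuv; apply: gS => // w /ST; exact: Tuv.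
Qed.

Lemma affine_offM g h S :
  affine_off h S -> affine_off g (h @` S)%fset -> affine_off (g * h)%g S.
Proof.
move=> hS gS u v uv Suv; have [l [c hc]] := hS u v uv Suv.
have [||k [b gb]] := gS (h u) (h v).
- by rewrite thompsonF_lt.
- by move=> _ /imfsetP[/= w wS ->]; rewrite !thompsonF_lt Suv.
exists (k + l), (2 ^ k * c + b) => x uxv; rewrite order_autME gb.
  by rewrite hc// expfzDr// mulrDr mulrA addrA.
by rewrite !order_aut_mono.
Qed.

Lemma affine_offV g S : affine_off g S -> affine_off (g^-1)%g (g @` S)%fset.
Proof.
move=> gS u v uv Suv; have [||k [b gb]] := gS ((g^-1)%g u) ((g^-1)%g v).
- by rewrite thompsonF_lt.
- move=> w wS; rewrite -(thompsonF_lt g) -[(w < _)%O](thompsonF_lt g) !thompsonFKV.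
  by apply: Suv; rewrite in_imfset.
exists (- k), (- (2 ^ (- k) * b)) => x /andP[ux xv].
have := gb ((g^-1)%g x); rewrite !order_aut_mono ux xv (thompsonFKV g) => -> //.
by rewrite mulrDr mulrA -expfzDr// addNr expr0z mul1r addrK.
Qed.

Lemma imfset_thompsonFM g h S : ((g * h)%g @` S = g @` (h @` S))%fset.
Proof. by rewrite imfset_comp. Qed.

Lemma imfset_thompsonF1 S : ((1%g : F) @` S = S)%fset.
Proof. exact: imfset_id. Qed.

(** The increasing enumeration of S is mapped by g to an increasing enumeration
    of the same set, and there is only one. *)
Lemma thompsonF_fixes g S : (g @` S)%fset = S -> {in S, forall x, g x = x}.
Proof.
move=> gS; pose s := sort <=%O (enum_fset S).
have ss : sorted <%O s by rewrite sort_lt_sorted fset_uniq.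
have /eq_in_map e : map g s = map id s.
  rewrite map_id; apply: lt_sorted_eq => // [|x].
    by rewrite sorted_map; apply: sub_sorted ss => x y /=; rewrite thompsonF_lt.
  rewrite mem_sort -gS; apply/mapP/imfsetP => /= -[y yS ->].
    by exists y; rewrite // mem_sort in yS.
  by exists y; rewrite // mem_sort.
by move=> x xS; apply: e; rewrite mem_sort.
Qed.

Lemma fset_floor S x : dyadic0 \in S ->
  exists2 u, u \in S & (u <= x)%O /\ forall w, w \in S -> (w <= x)%O -> (w <= u)%O.
Proof.
move=> S0; suff [u [uS ux um]] : exists u, [/\ u \in S, (u <= x)%O &
    forall w, w \in enum_fset S -> (w <= x)%O -> (w <= u)%O] by exists u.
have /allP : {subset enum_fset S <= S} by [].
elim: (enum_fset S) => [_|w s IHs /= /andP[wS /IHs[u [uS ux um]]]].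
  by exists dyadic0; rewrite S0 dyadic0_le.
have [wu|uw] := leP w u.
  by exists u; split=> // w'; rewrite in_cons => /predU1P[->//|]; exact: um.
have [wx|xw] := leP w x.
  exists w; split=> // w'; rewrite in_cons => /predU1P[->//|w's w'x].
  by rewrite (le_trans (um _ w's w'x))// ltW.
exists u; split=> // w'; rewrite in_cons => /predU1P[->|]; last exact: um.
by rewrite leNgt xw.
Qed.

Lemma fset_ceil S x : dyadic1 \in S ->
  exists2 v, v \in S & (x <= v)%O /\ forall w, w \in S -> (x <= w)%O -> (v <= w)%O.
Proof.
move=> S0; suff [u [uS ux um]] : exists u, [/\ u \in S, (x <= u)%O &
    forall w, w \in enum_fset S -> (x <= w)%O -> (u <= w)%O] by exists u.
have /allP : {subset enum_fset S <= S} by [].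
elim: (enum_fset S) => [_|w s IHs /= /andP[wS /IHs[u [uS ux um]]]].
  by exists dyadic1; rewrite S0 dyadic1_ge.
have [uw|wu] := leP u w.
  by exists u; split=> // w'; rewrite in_cons => /predU1P[->//|]; exact: um.
have [xw|wx] := leP x w.
  exists w; split=> // w'; rewrite in_cons => /predU1P[->//|w's w'x].
  by rewrite (le_trans _ (um _ w's w'x))// ltW.
exists u; split=> // w'; rewrite in_cons => /predU1P[->|]; last exact: um.
by rewrite leNgt wx.
Qed.

(** Rigidity, the reason why F acts freely on sufficiently fine finite sets: a
    point x outside S lies between two consecutive points u and v of S, which g
    fixes, and the only affine map fixing two points is the identity. *)
Lemma affine_off_fixed g S : dyadic0 \in S -> dyadic1 \in S ->
  affine_off g S -> (g @` S)%fset = S -> g = 1%g.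
Proof.
move=> S0 S1 gaff /thompsonF_fixes gS; apply: thompsonF_ext => x.
have [xS|xS] := boolP (x \in S); first exact: gS.
have [u uS [ux um]] := fset_floor x S0.
have [v vS [xv vm]] := fset_ceil x S1.
have ltux : (u < x)%O by rewrite lt_neqAle ux andbT; apply: contraNneq xS => <-.
have ltxv : (x < v)%O by rewrite lt_neqAle xv andbT; apply: contraNneq xS => ->.
have [||k [b gb]] := gaff u v; first exact: lt_trans ltxv.
  move=> w wS; apply/negP => /andP[uw wv].
  have [wx|/ltW xw] := leP w x; first by move: uw; rewrite ltNge um.
  by move: wv; rewrite ltNge vm.
have gu : dyadic_val u = 2 ^ k * dyadic_val u + b.
  by rewrite -gb ?gS// lexx/= ltW// (lt_trans ltux).
have gv : dyadic_val v = 2 ^ k * dyadic_val v + b.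
  by rewrite -gb ?gS// lexx/= andbT ltW// (lt_trans ltux).
have uv : dyadic_val u < dyadic_val v by rewrite lt_val (lt_trans ltux).
(* Subtracting gv and gu gives v - u = 2 ^ k * (v - u). *)
have a1 : (2 : rat) ^ k = 1.
  apply: (@mulIf _ (dyadic_val v - dyadic_val u)).
    by rewrite subr_eq0 gt_eqF.
  rewrite mul1r mulrBr; lra.
apply: val_inj => /=; rewrite gb ?ux//.
by move: gu; rewrite a1 !mul1r; lra.
Qed.

Definition marking_equiv S T : Prop :=
  exists2 g : F, affine_off g S & (g @` S)%fset = T.

Lemma marking_equiv_refl S : marking_equiv S S.
Proof.
exists (1%g : F); last exact: imfset_thompsonF1.
by move=> u v _ _; exists 0, 0 => x _; rewrite expr0z mul1r addr0.
Qed.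

Lemma marking_equiv_sym S T : marking_equiv S T -> marking_equiv T S.
Proof.
move=> [g gS <-]; exists (g^-1)%g; first exact: affine_offV.
by rewrite -imfset_thompsonFM mulVg imfset_thompsonF1.
Qed.

Lemma marking_equiv_trans S T U :
  marking_equiv S T -> marking_equiv T U -> marking_equiv S U.
Proof.
move=> [g gS gST] [h hT hTU]; exists (h * g)%g.
  by apply: affine_offM; rewrite ?gST.
by rewrite imfset_thompsonFM gST.
Qed.

(** The chosen set depends on the equivalence class of S only, since equivalent
    sets define equal predicates. *)
Definition marking_rep S : {fset D} := xget fset0 [set T | marking_equiv T S].

Lemma marking_repP S : marking_equiv (marking_rep S) S.
Proof.
exact: (@xgetI _ _ [set T | marking_equiv T S] S (marking_equiv_refl S)).
Qed.

Lemma marking_rep_eq S T : marking_equiv S T -> marking_rep S = marking_rep T.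
Proof.
move=> ST; congr xget; apply/seteqP; split=> U /= UT.
  exact: marking_equiv_trans ST.
by apply: marking_equiv_trans UT _; exact: marking_equiv_sym.
Qed.

Lemma marking_elt_ex S :
  exists g : F, affine_off g (marking_rep S) /\ (g @` marking_rep S)%fset = S.
Proof. by have [g] := marking_repP S; exists g. Qed.

Definition marking_elt S : F := sval (cid (marking_elt_ex S)).

Lemma marking_elt_affine S : affine_off (marking_elt S) (marking_rep S).
Proof. by rewrite /marking_elt; case: cid => ? []. Qed.

Lemma marking_elt_rep S : (marking_elt S @` marking_rep S)%fset = S.
Proof. by rewrite /marking_elt; case: cid => ? []. Qed.

(** Both sides are affine off the common representative of S and h S and map it
    onto h S, so they differ by an element to which [affine_off_fixed] applies;
    the representative contains 0 and 1 because F fixes these points. *)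
Lemma marking_elt_equivariant h S : dyadic0 \in S -> dyadic1 \in S ->
  affine_off h S -> marking_elt (h @` S)%fset = (h * marking_elt S)%g.
Proof.
move=> S0 S1 hS; set T := (h @` S)%fset.
have repT : marking_rep T = marking_rep S.
  by apply/esym/marking_rep_eq; exists h.
have eS := marking_elt_rep S; have eT := marking_elt_rep T; rewrite repT in eT.
have aS := @marking_elt_affine S.
have aT := @marking_elt_affine T; rewrite repT in aT.
move: (marking_elt S) (marking_elt T) (marking_rep S) eS eT aS aT.
move=> p q S' eS eT aS aT.
have hp : affine_off (h * p)%g S' by apply: affine_offM; rewrite ?eS.
have ehp : ((h * p)%g @` S')%fset = T by rewrite imfset_thompsonFM eS.
have mem_rep x : p x = x -> x \in S -> x \in S'.
  rewrite -{1}eS => px /imfsetP[/= y yS' xy]; rewrite -px in xy.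
  by rewrite (thompsonF_inj xy).
apply/esym/eqP; rewrite -(inj_eq (mulgI q^-1%g)) mulVg; apply/eqP.
apply: (@affine_off_fixed _ S').
- exact: mem_rep (thompsonF_fix0 p) S0.
- exact: mem_rep (thompsonF_fix1 p) S1.
- by apply: affine_offM; rewrite // ehp -eT; exact: affine_offV.
- by rewrite imfset_thompsonFM ehp -eT -imfset_thompsonFM mulVg imfset_thompsonF1.
Qed.

End Markings.

(** * From a mean on finite sets to a mean on F *)

(** Push the mean forward along [marking_elt], which is equivariant for h on the
    sets containing 0, 1 and the breakpoints of h. *)
Lemma absorbing_mean_amenable (R : realType)
    (nu : ({fset dyadic_unit} -> R) -> R) :
    is_mean (bounded_fun : set ({fset dyadic_unit} -> R)) nu ->
    (forall x, nu (fun S => (x \notin S)%:R) = 0) ->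
    (forall (g : thompsonF) f, bounded_fun f ->
      nu (fun S => f (g @` S)%fset) = nu f) ->
  amenable R thompsonF.
Proof.
move=> nu_mean nu0 nu_inv; exists (fun f => nu (fun S => f (marking_elt S))).
split; first by apply: mean_comp nu_mean => f; exact: bounded_fun_comp.
move=> f h bf; have bfm := bounded_fun_comp marking_elt bf.
rewrite -(nu_inv h _ bfm); have [E hE] := affine_off_ex h.
apply: (absorbing_mean_eq (E := (dyadic0 |` (dyadic1 |` E))%fset)) => //.
- exact: (bounded_fun_comp (fun S => h * marking_elt S)%g bf).
- exact: (bounded_fun_comp (fun S : {fset dyadic_unit} => h @` S)%fset bfm).
move=> S; rewrite !fsubUset !fsub1set => /and3P[S0 S1 ES].
by rewrite marking_elt_equivariant//; exact: affine_off_sub hE.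
Qed.

Section LampMean.
Context (R : realType) (H : groupType).
Local Notation N := (dsum dyadic_unit H).

(** The neighborhood of 1 formed by the pairs (1, u) works for every precision:
    right multiplication by such a pair does not move the first component. *)
Lemma LUCB_lamp (f : N -> R) : bounded_fun f ->
  LUCB (fun a : wreathF H => f a.1).
Proof.
move=> bf; split; first exact: bounded_fun_comp.
move=> e e0; exists [set b : wreathF H | b.1 = 1%g].
  by apply/wreathF_nbhsE; exists [::] => b [].
move=> [a g] [b h] /= ab; suff -> : a = b by rewrite subrr normr0 ltW.
move: ab => /(congr1 (thompsonF_act g)).
rewrite thompsonF_act_mul -!thompsonF_actM mulgV !thompsonF_act1 thompsonF_act_one.
by move=> /mulg1_eq; rewrite invgK.
Qed.

Lemma skew_amenable_lamp_mean : skew_amenable R (wreathF H) ->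
  exists m : (N -> R) -> R,
    [/\ is_mean (bounded_fun : set (N -> R)) m,
      forall f b, bounded_fun f -> m (fun a => f (b * a)%g) = m f
    & forall f (g : thompsonF), bounded_fun f ->
        m (fun a => f (thompsonF_act g a)) = m f].
Proof.
move=> [mu [mu_mean mu_inv]]; exists (fun f => mu (fun a => f a.1)); split.
- by apply: mean_comp mu_mean => f; exact: LUCB_lamp.
- move=> f b bf; rewrite -(mu_inv _ ((b, 1%g) : wreathF H) (LUCB_lamp bf)).
  by congr mu; apply/funext => a /=; rewrite thompsonF_act1.
- move=> f g bf; rewrite -(mu_inv _ ((1%g, g) : wreathF H) (LUCB_lamp bf)).
  by congr mu; apply/funext => a /=; rewrite mul1g.
Qed.

(** Translation by k at x carries the event a x = 1 to a disjoint event of the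
    same weight. *)
Lemma lamp_off_half (m : (N -> R) -> R) (k : H) x : k <> 1%g ->
    is_mean (bounded_fun : set (N -> R)) m ->
    (forall f b, bounded_fun f -> m (fun a => f (b * a)%g) = m f) ->
  m (fun a => (x \notin finsupp a)%:R) <= 2^-1.
Proof.
move=> k1 m_mean m_inv; have bi (P : pred N) := @bounded_fun_indic R N P.
set p := m _; suff : p + p <= 1 by lra.
rewrite -{2}[p](m_inv _ (dsum_at x k))// -(meanD m_mean)// -[leRHS](mean_cst m_mean).
apply: mean_le => //; [exact: bounded_funD|exact: bounded_fun_cst|move=> a].
rewrite -natrD lern1 !memNfinsupp dsumME dsum_atE eqxx.
by case: (a x =P 1%g) => [->|_] /=; [rewrite mulg1; case: eqP|case: eqP].
Qed.

Lemma finsupp_act (g : thompsonF) (a : N) :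
  finsupp (thompsonF_act g a) = (g @` finsupp a)%fset.
Proof.
apply/fsetP => y; rewrite mem_finsupp thompsonF_actE -mem_finsupp.
apply/idP/imfsetP => [ay|[z za ->]]; last by rewrite thompsonFK.
by exists ((g^-1)%g y); rewrite // thompsonFKV.
Qed.

End LampMean.

Theorem corollary9p8 (R : realType) (H : groupType)
    (H_nontrivial : exists h : H, h <> 1%g) (H_amenable : amenable R H) :
  skew_amenable R (wreathF H) <-> amenable R thompsonF.
Proof.
split=> [/skew_amenable_lamp_mean[m [m_mean m_mul m_act]]|F_amenable]; last first.
  apply/amenable_skew_amenable/wreathF_amenable => //.
  exact: dsum_amenable.
have [k k1] := H_nontrivial.
have [||nu [nu_mean nu0 nu_inv]] :=
    @absorbing_mean R dyadic_unit (fun f => m (fun a => f (finsupp a))).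
- by apply: mean_comp m_mean => f; exact: bounded_fun_comp.
- by move=> x; exact: lamp_off_half k1 m_mean m_mul.
apply: (absorbing_mean_amenable nu_mean nu0) => g; apply: nu_inv => f bf.
have bfs := bounded_fun_comp (fun a : dsum dyadic_unit H => finsupp a) bf.
rewrite -[RHS](m_act _ g bfs).
by congr m; apply/funext => a; rewrite finsupp_act.
Qed.
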